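(* Let $(X,x)$ be a pointed topological space and let $U$ be an open neighborhood of the identity element $[e_x]$ in $\pi_1^{qtop}(X,x)$. Then $\pi_1^{sg}(X,x)\subseteq U$. Moreover, $\pi_1^{sg}(X,x)\subseteq \overline{\{[e_x]\}}$, where the closure is taken in $\pi_1^{qtop}(X,x)$.
   Context: All homotopies of paths are relative to end points; $e_x$ is the constant loop at $x$. $\pi_1^{qtop}(X,x)$ is the group $\pi_1(X,x)$ with the quotient topology induced by the canonical map $q:\Omega(X,x)\to\pi_1(X,x)$, $q(\alpha)=[\alpha]$, where $\Omega(X,x)$ is the space of loops in $X$ based at $x$ with the compact-open topology. For $y\in X$, the small loop group $\pi_1^s(X,y)\le \pi_1(X,y)$ is the subgroup of all classes $[\beta]$ of loops $\beta$ at $y$ such that for every open neighborhood $V$ of $y$, $\beta$ is homotopic to a loop at $y$ lying in $V$. The SG (small generated) subgroup $\pi_1^{sg}(X,x)$ is the subgroup of $\pi_1(X,x)$ generated by all elements $[\alpha*\beta*\alpha^{-1}]$, where $\alpha$ is a path in $X$ with $\alpha(0)=x$ and $[\beta]\in\pi_1^s(X,\alpha(1))$; here $*$ is concatenation and $\alpha^{-1}$ the reversed path. *)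

(* Defs.v *)
From HB Require Import structures.
From mathcomp Require Import all_boot all_order all_algebra generic_quotient.
From mathcomp Require Import all_classical all_reals all_analysis homotopy.
From mathcomp Require Import ring lra.
Import numFieldNormedType.Exports.

Set Implicit Arguments.
Unset Strict Implicit.
Unset Printing Implicit Defensive.

Import Order.TTheory GRing.Theory Num.Theory.

Local Open Scope classical_set_scope.
Local Open Scope ring_scope.
Local Open Scope quotient_scope.

Definition unit_interval (R : realType) : Type := set_type `[(0 : R), 1].

Section unit_interval.
Variable R : realType.
Local Notation I := (unit_interval R).

Definition ui_val (t : I) : R := set_val t.

HB.instance Definition _ := Topological.copy I (set_type `[(0 : R), 1]).

Lemma ui_val_ge0 (t : I) : 0 <= ui_val t.
Proof. by have := set_valP t; rewrite /= in_itv /= => /andP[]. Qed.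

Lemma ui_val_le1 (t : I) : ui_val t <= 1.
Proof. by have := set_valP t; rewrite /= in_itv /= => /andP[]. Qed.

Lemma ui_val_inj : injective ui_val.
Proof. by move=> s t; apply: eq_sig_hprop. Qed.

Lemma ui_val_continuous : continuous ui_val.
Proof. exact: initial_continuous. Qed.

Lemma clampP (r : R) : Num.max 0 (Num.min 1 r) \in `[(0 : R), 1]%classic.
Proof.
by rewrite inE /= in_itv /= le_max lexx /= ge_max ler01 ge_min lexx.
Qed.

(* Nearest-point retraction of the line onto the unit interval; it lets the
   affine parameter changes below be written on the real line. *)
Definition clamp (r : R) : I := exist _ (Num.max 0 (Num.min 1 r)) (clampP r).

Lemma clampE r : ui_val (clamp r) = Num.max 0 (Num.min 1 r).
Proof. by []. Qed.

Lemma ui_valK : cancel ui_val clamp.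
Proof.
move=> t; apply: ui_val_inj; rewrite clampE.
by rewrite (min_idPr (ui_val_le1 t)) (max_idPr (ui_val_ge0 t)).
Qed.

Lemma clampK r : 0 <= r <= 1 -> ui_val (clamp r) = r.
Proof. by case/andP=> r0 r1; rewrite clampE (min_idPr r1) (max_idPr r0). Qed.

Lemma clamp_continuous : continuous clamp.
Proof.
have c : continuous (fun r : R => Num.max 0 (Num.min 1 r)).
  move=> r; apply: (@continuous_max R R (cst 0) (fun r => Num.min 1 r)).
    exact: cst_continuous.
  apply: (@continuous_min R R (cst 1) id); first exact: cst_continuous.
  exact: (fun U => id).
apply/continuousP => A [B oB <-].
by move/continuousP: c; apply.
Qed.

Lemma zero_one_clamp : clamp 0 != clamp 1.
Proof.
apply/eqP => /(congr1 ui_val); rewrite !clampK ?lexx ?ler01 // => /eqP.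
by rewrite eq_sym oner_eq0.
Qed.

HB.instance Definition _ := isBiPointed.Build I zero_one_clamp.

Lemma ui_val0 : ui_val zero = 0.
Proof. by rewrite clampK // lexx ler01. Qed.

Lemma ui_val1 : ui_val one = 1.
Proof. by rewrite clampK // lexx ler01. Qed.

End unit_interval.

Section continuity.
Variables (R : realType) (T : topologicalType).
Local Notation I := (unit_interval R).

Lemma continuousD2 (f g : T -> R) :
  continuous f -> continuous g -> continuous (fun t => f t + g t).
Proof. by move=> cf cg t; apply: continuousD; [exact: cf|exact: cg]. Qed.

Lemma continuous_onem (f : T -> R) :
  continuous f -> continuous (fun t => 1 - f t).
Proof.
move=> cf; apply: continuousD2; first exact: cst_continuous.
by move=> t; apply: continuousN; exact: cf.
Qed.

Lemma continuousM2 (f g : T -> R) :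
  continuous f -> continuous g -> continuous (fun t => f t * g t).
Proof. by move=> cf cg t; apply: continuousM; [exact: cf|exact: cg]. Qed.

Lemma continuous_min2 (f g : T -> R) :
  continuous f -> continuous g -> continuous (fun t => Num.min (f t) (g t)).
Proof. by move=> cf cg t; apply: continuous_min; [exact: cf|exact: cg]. Qed.

Lemma continuous_affine (a b : R) (f : T -> R) :
  continuous f -> continuous (fun t => a * f t + b).
Proof.
by move=> cf; apply: continuousD2; [apply: continuousM2 => //|];
  exact: cst_continuous.
Qed.

Lemma continuous_comp2 (U V : topologicalType) (f : T -> U) (g : U -> V) :
  continuous f -> continuous g -> continuous (fun t => g (f t)).
Proof. by move=> cf cg t; apply: continuous_comp; [exact: cf|exact: cg]. Qed.

Lemma continuous_pair2 (U V : topologicalType) (f : T -> U) (g : T -> V) :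
  continuous f -> continuous g -> continuous (fun t => (f t, g t)).
Proof. by move=> cf cg t; apply: cvg_pair; [exact: cf|exact: cg]. Qed.

Lemma continuous_paste (X : topologicalType) (c : R) (h : T -> R)
    (f g : T -> X) :
  continuous h -> continuous f -> continuous g ->
  (forall t, h t = c -> f t = g t) ->
  continuous (fun t => if h t <= c then f t else g t).
Proof.
move=> ch cf cg fg; apply/continuous_closedP => W cW.
have -> : (fun t => if h t <= c then f t else g t) @^-1` W =
    (h @^-1` [set r | r <= c] `&` f @^-1` W) `|`
    (h @^-1` [set r | c <= r] `&` g @^-1` W).
  apply/seteqP; split => t /=.
    by case: leP => hc Wt; [left|right; split => //; exact: ltW].
  case=> -[hc Wt]; first by rewrite hc.
  case: leP => // hc'; rewrite fg //.
  by apply/eqP; rewrite eq_le hc' hc.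
apply: closedU; apply: closedI.
- by apply: (continuous_closedP h).1 => //; exact: closed_le.
- exact: (continuous_closedP f).1.
- by apply: (continuous_closedP h).1 => //; exact: closed_ge.
- exact: (continuous_closedP g).1.
Qed.

End continuity.

Lemma fst_continuous (S T : topologicalType) : continuous (@fst S T).
Proof. by move=> [s t]; exact: cvg_fst. Qed.

Lemma snd_continuous (S T : topologicalType) : continuous (@snd S T).
Proof. by move=> [s t]; exact: cvg_snd. Qed.

Section clamp.
Variable R : realType.

Lemma clamp_le0 (r : R) : r <= 0 -> clamp r = zero.
Proof.
move=> r0; apply: ui_val_inj; rewrite ui_val0 clampE.
by rewrite (min_idPr _) ?(le_trans r0) //; apply/max_idPl.
Qed.

Lemma clamp_ge1 (r : R) : 1 <= r -> clamp r = one.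
Proof.
move=> r1; apply: ui_val_inj; rewrite ui_val1 clampE (min_idPl r1).
by apply/max_idPr.
Qed.

End clamp.

Section paths.
Variables (R : realType) (X : topologicalType).
Local Notation I := (unit_interval R).

Section concat.
Variables (x y z : X).
Variables (p : {path I from x to y}) (q : {path I from y to z}).

Definition concat_fun (t : I) : X :=
  if ui_val t <= 2^-1 then p (clamp (2 * ui_val t))
  else q (clamp (2 * ui_val t - 1)).

Lemma concat_fun_continuous : continuous concat_fun.
Proof.
apply: continuous_paste.
- exact: ui_val_continuous.
- apply: (@continuous_comp2 _ _ _ (fun t : I => clamp (2 * ui_val t)) p);
    last exact: cts_fun.
  apply: continuous_comp2; last exact: clamp_continuous.
  by apply: continuousM2; [exact: cst_continuous|exact: ui_val_continuous].
- apply: (@continuous_comp2 _ _ _ (fun t : I => clamp (2 * ui_val t - 1)) q);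
    last exact: cts_fun.
  apply: continuous_comp2; last exact: clamp_continuous.
  by apply: continuous_affine; exact: ui_val_continuous.
- move=> t ->; rewrite mulfV ?pnatr_eq0 // subrr.
  by rewrite clamp_ge1 // clamp_le0 // path_one path_zero.
Qed.

Lemma concat_fun0 : concat_fun zero = x.
Proof.
by rewrite /concat_fun ui_val0 invr_ge0 ler0n mulr0 clamp_le0 // path_zero.
Qed.

Lemma concat_fun1 : concat_fun one = z.
Proof.
rewrite /concat_fun ui_val1 ifF; last by apply/negbTE; rewrite -ltNge; lra.
by rewrite clamp_ge1 ?path_one //; lra.
Qed.

Definition concat : {path I from x to z} :=
  mk_path concat_fun_continuous concat_fun0 concat_fun1.

Lemma concat_clampl (r : R) : 0 <= r <= 2^-1 ->
  concat (clamp r) = p (clamp (2 * r)).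
Proof.
move=> /andP[r0 r1]; rewrite /= /mk_path /concat_fun clampK ?r1 //.
by apply/andP; split; lra.
Qed.

Lemma concat_clampr (r : R) : 2^-1 < r <= 1 ->
  concat (clamp r) = q (clamp (2 * r - 1)).
Proof.
move=> /andP[r0 r1]; rewrite /= /mk_path /concat_fun clampK ?leNgt ?r0 //.
by apply/andP; split; lra.
Qed.

End concat.

Section reverse.
Variables (x y : X) (p : {path I from x to y}).

Definition reverse_fun (t : I) : X := p (clamp (1 - ui_val t)).

Lemma reverse_fun_continuous : continuous reverse_fun.
Proof.
apply: (@continuous_comp2 _ _ _ (fun t : I => clamp (1 - ui_val t)) p);
  last exact: cts_fun.
apply: continuous_comp2; last exact: clamp_continuous.
by apply: continuous_onem; exact: ui_val_continuous.
Qed.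

Lemma reverse_fun0 : reverse_fun zero = y.
Proof. by rewrite /reverse_fun ui_val0 subr0 path_one. Qed.

Lemma reverse_fun1 : reverse_fun one = x.
Proof. by rewrite /reverse_fun ui_val1 subrr path_zero. Qed.

Definition reverse : {path I from y to x} :=
  mk_path reverse_fun_continuous reverse_fun0 reverse_fun1.

Lemma reverse_clamp (r : R) : 0 <= r <= 1 ->
  reverse (clamp r) = p (clamp (1 - r)).
Proof. by move=> r01; rewrite /= /mk_path /reverse_fun clampK. Qed.

End reverse.

Definition homotopic (x y : X) (p q : {path I from x to y}) : Prop :=
  exists H : I * I -> X, [/\ continuous H,
    forall t, H (t, zero) = p t, forall t, H (t, one) = q t,
    forall s, H (zero, s) = x & forall s, H (one, s) = y].

Section homotopic.
Variables (x y : X).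
Implicit Types p q r : {path I from x to y}.

Lemma homotopic_refl p : homotopic p p.
Proof.
exists (fun ts => p ts.1); split=> // [|s|s] /=.
- apply: (@continuous_comp2 _ _ _ fst p); first exact: fst_continuous.
  exact: cts_fun.
- exact: path_zero.
- exact: path_one.
Qed.

Lemma homotopic_sym p q : homotopic p q -> homotopic q p.
Proof.
case=> H [cH H0 H1 Hx Hy].
exists (fun ts => H (ts.1, clamp (1 - ui_val ts.2))); split=> [|t|t|s|s] //=.
- apply: (@continuous_comp2 _ _ _
    (fun ts : I * I => (ts.1, clamp (1 - ui_val ts.2))) H) => //.
  apply: continuous_pair2; first exact: fst_continuous.
  apply: continuous_comp2; last exact: clamp_continuous.
  apply: continuous_onem.
  apply: (@continuous_comp2 _ _ _ snd (@ui_val R)).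
    exact: snd_continuous.
  exact: ui_val_continuous.
- by rewrite ui_val0 subr0 clamp_ge1.
- by rewrite ui_val1 subrr clamp_le0.
Qed.

Lemma homotopic_trans q p r : homotopic p q -> homotopic q r -> homotopic p r.
Proof.
case=> H [cH H0 H1 Hx Hy] [K [cK K0 K1 Kx Ky]].
have cs : continuous (fun ts : I * I => ui_val ts.2).
  apply: (@continuous_comp2 _ _ _ snd (@ui_val R)); first exact: snd_continuous.
  exact: ui_val_continuous.
exists (fun ts => if ui_val ts.2 <= 2^-1 then H (ts.1, clamp (2 * ui_val ts.2))
  else K (ts.1, clamp (2 * ui_val ts.2 - 1))); split=> [|t|t|s|s] /=.
- apply: continuous_paste => //.
  + apply: (@continuous_comp2 _ _ _
      (fun ts : I * I => (ts.1, clamp (2 * ui_val ts.2))) H) => //.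
    apply: continuous_pair2; first exact: fst_continuous.
    apply: continuous_comp2; last exact: clamp_continuous.
    by apply: continuousM2 => //; exact: cst_continuous.
  + apply: (@continuous_comp2 _ _ _
      (fun ts : I * I => (ts.1, clamp (2 * ui_val ts.2 - 1))) K) => //.
    apply: continuous_pair2; first exact: fst_continuous.
    apply: continuous_comp2; last exact: clamp_continuous.
    exact: continuous_affine.
  + move=> ts ->; rewrite mulfV ?pnatr_eq0 // subrr.
    by rewrite clamp_ge1 // clamp_le0 // H1 K0.
- by rewrite ui_val0 invr_ge0 ler0n mulr0 clamp_le0.
- rewrite ui_val1 ifF; last by apply/negbTE; rewrite -ltNge; lra.
  by rewrite clamp_ge1 //; lra.
- by rewrite Hx Kx if_same.
- by rewrite Hy Ky if_same.
Qed.

Lemma homotopic_reparam (r : I -> X) (f g : I -> R) p q :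
  continuous r -> continuous f -> continuous g ->
  f zero = g zero -> f one = g one ->
  (forall t, p t = r (clamp (f t))) -> (forall t, q t = r (clamp (g t))) ->
  homotopic p q.
Proof.
move=> cr cf cg fg0 fg1 pE qE.
have cs : continuous (fun ts : I * I => ui_val ts.2).
  apply: (@continuous_comp2 _ _ _ snd (@ui_val R)); first exact: snd_continuous.
  exact: ui_val_continuous.
pose F (ts : I * I) : R := (1 - ui_val ts.2) * f ts.1 + ui_val ts.2 * g ts.1.
exists (fun ts => r (clamp (F ts))).
split=> [|t|t|s|s]; rewrite /F /=.
- apply: (@continuous_comp2 _ _ _ (fun ts : I * I => clamp (F ts)) r) => //.
  apply: continuous_comp2; last exact: clamp_continuous.
  apply: continuousD2; apply: continuousM2 => //.
  + exact: continuous_onem.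
  + by apply: (@continuous_comp2 _ _ _ fst f) => //; exact: fst_continuous.
  + by apply: (@continuous_comp2 _ _ _ fst g) => //; exact: fst_continuous.
- by rewrite ui_val0 subr0 mul1r mul0r addr0 pE.
- by rewrite ui_val1 subrr mul1r mul0r add0r qE.
- by rewrite -fg0 -mulrDl subrK mul1r -pE path_zero.
- by rewrite -fg1 -mulrDl subrK mul1r -pE path_one.
Qed.

End homotopic.

Lemma homotopic_concat (x y z : X) (p p' : {path I from x to y})
    (q q' : {path I from y to z}) :
  homotopic p p' -> homotopic q q' -> homotopic (concat p q) (concat p' q').
Proof.
case=> H [cH H0 H1 Hx Hy] [K [cK K0 K1 Kx Ky]].
have ct : continuous (fun ts : I * I => ui_val ts.1).
  apply: (@continuous_comp2 _ _ _ fst (@ui_val R)); first exact: fst_continuous.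
  exact: ui_val_continuous.
exists (fun ts => if ui_val ts.1 <= 2^-1 then H (clamp (2 * ui_val ts.1), ts.2)
  else K (clamp (2 * ui_val ts.1 - 1), ts.2)); split=> [|t|t|s|s] /=.
- apply: continuous_paste => //.
  + apply: (@continuous_comp2 _ _ _
      (fun ts : I * I => (clamp (2 * ui_val ts.1), ts.2)) H) => //.
    apply: continuous_pair2; last exact: snd_continuous.
    apply: continuous_comp2; last exact: clamp_continuous.
    by apply: continuousM2 => //; exact: cst_continuous.
  + apply: (@continuous_comp2 _ _ _
      (fun ts : I * I => (clamp (2 * ui_val ts.1 - 1), ts.2)) K) => //.
    apply: continuous_pair2; last exact: snd_continuous.
    apply: continuous_comp2; last exact: clamp_continuous.
    exact: continuous_affine.
  + move=> ts ->; rewrite mulfV ?pnatr_eq0 // subrr.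
    by rewrite clamp_ge1 // clamp_le0 // Hy Kx.
- by rewrite H0 K0.
- by rewrite H1 K1.
- by rewrite ui_val0 invr_ge0 ler0n mulr0 clamp_le0.
- rewrite ui_val1 ifF; last by apply/negbTE; rewrite -ltNge; lra.
  by rewrite clamp_ge1 ?Ky //; lra.
Qed.

Lemma homotopic_reverse (x y : X) (p q : {path I from x to y}) :
  homotopic p q -> homotopic (reverse p) (reverse q).
Proof.
case=> H [cH H0 H1 Hx Hy].
exists (fun ts => H (clamp (1 - ui_val ts.1), ts.2)); split=> [|t|t|s|s] /=.
- apply: (@continuous_comp2 _ _ _
    (fun ts : I * I => (clamp (1 - ui_val ts.1), ts.2)) H) => //.
  apply: continuous_pair2; last exact: snd_continuous.
  apply: continuous_comp2; last exact: clamp_continuous.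
  apply: continuous_onem.
  apply: (@continuous_comp2 _ _ _ fst (@ui_val R)); first exact: fst_continuous.
  exact: ui_val_continuous.
- by rewrite H0.
- by rewrite H1.
- by rewrite ui_val0 subr0 clamp_ge1.
- by rewrite ui_val1 subrr clamp_le0.
Qed.

Lemma concatA (x y z w : X) (p : {path I from x to y})
    (q : {path I from y to z}) (r : {path I from z to w}) :
  homotopic (concat p (concat q r)) (concat (concat p q) r).
Proof.
pose f (t : I) : R := ui_val t.
pose g (t : I) : R :=
  Num.min (2 * ui_val t + 0)
    (Num.min (1 * ui_val t + 4^-1) (2^-1 * ui_val t + 2^-1)).
have cv := @ui_val_continuous R.
apply: (@homotopic_reparam _ _ (concat p (concat q r)) f g).
- exact: cts_fun.
- exact: cv.
- by do 2?apply: continuous_min2; exact: continuous_affine.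
- rewrite /f /g ui_val0 !mulr0 !add0r (min_idPl _) ?(min_idPl _) //; lra.
- rewrite /f /g ui_val1; apply/esym; rewrite (min_idPr _) ?(min_idPr _); lra.
- by move=> t; rewrite /f ui_valK.
move=> t; rewrite -[t in LHS]ui_valK /g.
have := ui_val_ge0 t; have := ui_val_le1 t.
move: (ui_val t) => u; set m := Num.min _ _ => u1 u0.
have mE v : v = 2 * u + 0 \/ v = 1 * u + 4^-1 \/ v = 2^-1 * u + 2^-1 ->
    v <= 2 * u + 0 -> v <= 1 * u + 4^-1 -> v <= 2^-1 * u + 2^-1 -> m = v.
  move=> ve v1 v2 v3; rewrite /m.
  case: (leP (1 * u + 4^-1) (2^-1 * u + 2^-1)) => ?; case: leP => ?; lra.
case: (leP u 2^-1) => u12; last first.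
  have -> : m = 2^-1 * u + 2^-1 by apply: mE; lra.
  do 3!(rewrite concat_clampr; last by apply/andP; split; lra).
  by congr (r (clamp _)); lra.
rewrite concat_clampl; last by apply/andP; split; lra.
case: (leP (2 * u) 2^-1) => u14.
  have -> : m = 2 * u by apply: mE; lra.
  by do 2!(rewrite concat_clampl; last by apply/andP; split; lra).
have -> : m = u + 4^-1 by apply: mE; lra.
do 2!(rewrite concat_clampr; last by apply/andP; split; lra).
rewrite concat_clampl; last by apply/andP; split; lra.
by congr (q (clamp _)); lra.
Qed.

Lemma concat1p (x y : X) (p : {path I from x to y}) :
  homotopic (concat (cst x : {path I from x to x}) p) p.
Proof.
have cv := @ui_val_continuous R.
apply: (@homotopic_reparam _ _ p
  (fun t => ui_val (clamp (2 * ui_val t + (-1)))) (@ui_val R)).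
- exact: cts_fun.
- apply: continuous_comp2 => //.
  by apply: continuous_comp2; [exact: continuous_affine|exact: clamp_continuous].
- exact: cv.
- by rewrite ui_val0 clamp_le0 ?ui_val0 //; lra.
- by rewrite ui_val1 clamp_ge1 ?ui_val1 //; lra.
- move=> t; rewrite ui_valK /= /mk_path /concat_fun; case: leP => // t1.
  have -> : clamp (2 * ui_val t + -1) = zero by apply: clamp_le0; lra.
  by rewrite path_zero.
- by move=> t; rewrite ui_valK.
Qed.

Lemma concatp1 (x y : X) (p : {path I from x to y}) :
  homotopic (concat p (cst y : {path I from y to y})) p.
Proof.
have cv := @ui_val_continuous R.
apply: (@homotopic_reparam _ _ p
  (fun t => ui_val (clamp (2 * ui_val t + 0))) (@ui_val R)).
- exact: cts_fun.
- apply: continuous_comp2 => //.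
  by apply: continuous_comp2; [exact: continuous_affine|exact: clamp_continuous].
- exact: cv.
- by rewrite ui_val0 clamp_le0 ?ui_val0 //; lra.
- by rewrite ui_val1 clamp_ge1 ?ui_val1 //; lra.
- move=> t; rewrite ui_valK addr0 /= /mk_path /concat_fun; case: leP => // t1.
  have -> : clamp (2 * ui_val t) = one by apply: clamp_ge1; lra.
  by rewrite path_one.
- by move=> t; rewrite ui_valK.
Qed.

Lemma concatpV (x y : X) (p : {path I from x to y}) :
  homotopic (concat p (reverse p)) (cst x : {path I from x to x}).
Proof.
have cv := @ui_val_continuous R.
apply: (@homotopic_reparam _ _ p
  (fun t => Num.min (2 * ui_val t + 0) (-2 * ui_val t + 2)) (fun=> 0)).
- exact: cts_fun.
- by apply: continuous_min2; exact: continuous_affine.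
- exact: cst_continuous.
- by rewrite ui_val0 (min_idPl _); lra.
- by rewrite ui_val1 (min_idPr _); lra.
- move=> t; rewrite -[t in LHS]ui_valK.
  have := ui_val_ge0 t; have := ui_val_le1 t; move: (ui_val t) => u u1 u0.
  case: (leP u 2^-1) => u12.
    rewrite concat_clampl; last by apply/andP; split; lra.
    by rewrite (min_idPl _) ?addr0 //; lra.
  rewrite concat_clampr; last by apply/andP; split; lra.
  rewrite reverse_clamp; last by apply/andP; split; lra.
  by rewrite (min_idPr _); [congr (p (clamp _))|]; lra.
- by move=> t; rewrite clamp_le0 // path_zero.
Qed.

Lemma reverseK (x y : X) (p : {path I from x to y}) : reverse (reverse p) = p.
Proof.
apply/path_eqP => t; rewrite -(ui_valK t).
have := ui_val_ge0 t; have := ui_val_le1 t => u1 u0.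
rewrite !reverse_clamp ?subKr //; apply/andP; split; lra.
Qed.

Lemma concatVp (x y : X) (p : {path I from x to y}) :
  homotopic (concat (reverse p) p) (cst y : {path I from y to y}).
Proof. by rewrite -{2}(reverseK p); exact: concatpV. Qed.

End paths.

Section fundamental_group.
Variables (R : realType) (X : topologicalType) (x : X).
Local Notation I := (unit_interval R).

(* The library topologizes path types as subspaces of the compact-open function
   space. *)
Definition loop_space : Type := {path I from x to x}.

HB.instance Definition _ := Topological.copy loop_space {path I from x to x}.

Definition homotopicb (a b : loop_space) : bool := `[< homotopic a b >].

Lemma homotopicb_refl : reflexive homotopicb.
Proof. by move=> a; apply/asboolP; exact: homotopic_refl. Qed.

Lemma homotopicb_sym : symmetric homotopicb.
Proof.
by move=> a b; apply/asbool_equiv_eq; split; exact: homotopic_sym.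
Qed.

Lemma homotopicb_trans : transitive homotopicb.
Proof.
by move=> b a c /asboolP ab /asboolP bc; apply/asboolP/(homotopic_trans ab bc).
Qed.

Canonical homotopic_equiv :=
  EquivRel homotopicb homotopicb_refl homotopicb_sym homotopicb_trans.

Definition pi1 : Type := {eq_quot homotopic_equiv}.

(* As a topological space this is the quasitopological fundamental group; the
   group structure is put on the same type. *)
HB.instance Definition _ := Topological.copy pi1 (quotient_topology pi1).
HB.instance Definition _ := Quotient.on pi1.


Definition homotopy_class (a : loop_space) : pi1 := \pi_pi1 a.

Definition constant_loop : loop_space := (cst x : {path I from x to x}).

Lemma homotopy_classP (a b : loop_space) :
  homotopy_class a = homotopy_class b <-> homotopic a b.
Proof.
split=> [/(eqmodP homotopic_equiv)/asboolP //|ab].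
by apply/(eqmodP homotopic_equiv)/asboolP.
Qed.

Lemma homotopic_repr (a : loop_space) : homotopic (repr (homotopy_class a)) a.
Proof. by apply/homotopy_classP; rewrite /homotopy_class reprK. Qed.

Lemma pi1_ind (P : pi1 -> Prop) :
  (forall a, P (homotopy_class a)) -> forall c, P c.
Proof. by move=> Pa c; rewrite -[c]reprK; exact: Pa. Qed.

Definition pi1_one : pi1 := homotopy_class constant_loop.

Definition pi1_mul (c d : pi1) : pi1 :=
  homotopy_class (concat (repr c) (repr d)).

Definition pi1_inv (c : pi1) : pi1 := homotopy_class (reverse (repr c)).

Lemma pi1_mulE (a b : loop_space) :
  pi1_mul (homotopy_class a) (homotopy_class b) = homotopy_class (concat a b).
Proof.
by apply/homotopy_classP; apply: homotopic_concat; exact: homotopic_repr.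
Qed.

Lemma pi1_invE (a : loop_space) :
  pi1_inv (homotopy_class a) = homotopy_class (reverse a).
Proof.
by apply/homotopy_classP; apply: homotopic_reverse; exact: homotopic_repr.
Qed.

Lemma pi1_mulA : associative pi1_mul.
Proof.
elim/pi1_ind=> a; elim/pi1_ind=> b; elim/pi1_ind=> c.
by rewrite !pi1_mulE; apply/homotopy_classP; exact: concatA.
Qed.

Lemma pi1_mul1 : left_id pi1_one pi1_mul.
Proof.
by elim/pi1_ind=> a; rewrite pi1_mulE; apply/homotopy_classP; exact: concat1p.
Qed.

Lemma pi1_mulr1 : right_id pi1_one pi1_mul.
Proof.
by elim/pi1_ind=> a; rewrite pi1_mulE; apply/homotopy_classP; exact: concatp1.
Qed.

Lemma pi1_mulV : left_inverse pi1_one pi1_inv pi1_mul.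
Proof.
elim/pi1_ind=> a; rewrite pi1_invE pi1_mulE.
by apply/homotopy_classP; exact: concatVp.
Qed.

Lemma pi1_mulrV : right_inverse pi1_one pi1_inv pi1_mul.
Proof.
elim/pi1_ind=> a; rewrite pi1_invE pi1_mulE.
by apply/homotopy_classP; exact: concatpV.
Qed.

HB.instance Definition _ := isGroup.Build pi1
  pi1_mulA pi1_mul1 pi1_mulr1 pi1_mulV pi1_mulrV.

End fundamental_group.

Section small_generated.
Variables (R : realType) (X : topologicalType).
Local Notation I := (unit_interval R).

Definition small_loop (y : X) (b : loop_space R y) : Prop :=
  forall V : set X, open V -> V y ->
    exists2 c : loop_space R y, homotopic b c & range c `<=` V.

Definition pi1_small (y : X) : set (pi1 R y) :=
  [set homotopy_class b | b in @small_loop y].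

Lemma pi1_small_group_closed (y : X) : group_closed (mem (pi1_small (y := y))).
Proof.
split=> [|u v].
  rewrite inE; exists (constant_loop R y) => // V _ Vy.
  by exists (constant_loop R y); [exact: homotopic_refl|move=> _ [t _ <-]].
rewrite !inE => -[a sa <-] [b sb <-]; exists (concat a (reverse b)); last first.
  by rewrite /= -pi1_mulE -pi1_invE.
move=> V oV Vy; have [a' aa' a'V] := sa _ oV Vy; have [b' bb' b'V] := sb _ oV Vy.
exists (concat a' (reverse b')).
  by apply: homotopic_concat => //; exact: homotopic_reverse.
move=> _ [t _ <-]; rewrite /= /mk_path /concat_fun /= /mk_path /reverse_fun.
by case: ifP => _; [apply: a'V|apply: b'V]; exact: imageT.
Qed.

Definition generated_subgroup (G : groupType) (A : set G) : set G :=
  smallest (fun H : set G => group_closed (mem H)) A.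

Definition sg_generator (x : X) : set (pi1 R x) :=
  [set g | exists (y : X) (a : {path I from x to y}) (b : loop_space R y),
    pi1_small (homotopy_class b) /\
    g = homotopy_class (concat (concat a b) (reverse a))].

Definition pi1_sg (x : X) : set (pi1 R x) :=
  generated_subgroup (@sg_generator x).

End small_generated.

Arguments pi1_small R {X} y _.
Arguments sg_generator R {X} x _.
Arguments pi1_sg R {X} x _.

(* Main.v *)
(* The classes lying in every open neighborhood of the identity form a subgroup,
   because inversion and right translations of the quasitopological fundamental
   group are continuous.  A basic compact-open neighborhood of the constant loop
   at y only asks finitely many compact sets to be sent into open neighborhoods
   of y, hence contains every loop that stays close enough to y; pulling an open
   set back along the continuous map c |-> a * c * a^-1 therefore puts all the
   generators of the SG subgroup in this subgroup.  The statement on the closure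
   follows by translating a neighborhood of g to a neighborhood of the identity
   and using that it contains g^-1. *)
Require Import Defs.
From mathcomp Require Import all_boot all_order all_algebra.
From mathcomp Require Import all_classical all_reals all_analysis.
From mathcomp Require Import homotopy.

Set Implicit Arguments.
Unset Strict Implicit.
Unset Printing Implicit Defensive.

Import Order.TTheory GRing.Theory Num.Theory.
Import numFieldNormedType.Exports.

Local Open Scope classical_set_scope.

Section path_topology.
Variables (i : bpTopologicalType) (T : topologicalType).

Lemma path_compact_open_open (x y : T) (K : set i) (O : set T) :
  compact K -> open O ->
  open ([set p | forall t, K t -> O (p t)] : set {path i from x to y}).
Proof.
move=> cK oO; exists [set g | g @` K `<=` O]; first exact: compact_open_open.
apply/seteqP; split=> p /= pKO; first by move=> t Kt; apply: pKO; exists t.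
by move=> _ [t Kt <-]; exact: pKO.
Qed.

Lemma path_map_continuous (x y z w : T) (A : set i) (phi : i -> i)
    (F : {path i from x to y} -> {path i from z to w}) :
  closed A -> continuous phi ->
  (forall p t, A t -> F p t = p (phi t)) ->
  (forall p q t, ~ A t -> F p t = F q t) ->
  continuous F.
Proof.
move=> cA cphi FA FnA.
apply: (@continuous_comp_initial _ _ _
  (id : {path i from z to w} -> {compact-open, i -> T})).
move=> p; apply/compact_open_cvgP; first by apply: fmap_filter; exact: nbhs_filter.
move=> K O cK oO FpKO.
have oN := @path_compact_open_open x y (phi @` (K `&` A)) O _ oO.
have Np : nbhs p [set q : {path i from x to y} |
    forall t, (phi @` (K `&` A)) t -> O (q t)].
  apply: open_nbhs_nbhs; split.
    apply: oN; apply: continuous_compact; last exact: compact_closedI.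
    exact: continuous_subspaceT.
  by move=> _ [t [Kt At] <-]; rewrite -FA //; apply: FpKO; exists t.
apply: filterS Np => q qO _ [t Kt <-] /=.
have [At|nAt] := pselect (A t); first by rewrite FA //; apply: qO; exists t.
by rewrite (FnA q p) //; apply: FpKO; exists t.
Qed.

Lemma nbhs_cst_path (y : T) (W : set {path i from y to y}) :
  open W -> W (cst y : {path i from y to y}) ->
  exists V : set T, [/\ open V, V y &
    forall p : {path i from y to y}, range p `<=` V -> W p].
Proof.
case=> B oB <- Be.
pose inside (V : set T) : set {compact-open, i -> T} := [set g | range g `<=` V].
(* Once this filter converges to the constant map, it contains the open set [B], which yields one
   [V]. Being a filter, it absorbs finite intersections, so convergence is tested on a single pair
   [K], [O]. *)
pose F := filter_from (fun V : set T => open V /\ V y) inside.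
have FF : Filter F.
  apply: filter_from_filter; first by exists setT; split=> //; exact: openT.
  move=> V V' [oV Vy] [oV' V'y]; exists (V `&` V').
    by split; [exact: openI|split].
  by move=> g gV; split=> s /gV [].
have : F --> (cst y : {compact-open, i -> T}).
  apply/compact_open_cvgP => K O _ oO KO.
  (* Only a nonempty [K] forces [y] to lie in [O]. *)
  have [->|/set0P[t Kt]] := eqVneq K set0.
    exists setT; first by split=> //; exact: openT.
    by move=> g _; rewrite /= image_set0.
  exists O; first by split=> //; apply: KO; exists t.
  by move=> g gO _ [s _ <-]; apply: gO; exists s.
move=> /(_ B (open_nbhs_nbhs (conj oB Be))) [V [oV Vy] VB].
by exists V; split=> // p pV; exact: VB.
Qed.

End path_topology.

Section loop_operations.
Variables (R : realType) (X : topologicalType).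
Local Notation I := (unit_interval R).
Local Open Scope ring_scope.

Let ui_le (r : R) : closed [set t : I | ui_val t <= r].
Proof.
exact: ((continuous_closedP _).1 (@ui_val_continuous R) _ (@closed_le R r)).
Qed.

Let ui_ge (r : R) : closed [set t : I | r <= ui_val t].
Proof.
exact: ((continuous_closedP _).1 (@ui_val_continuous R) _ (@closed_ge R r)).
Qed.

Let clamp_affine (a b : R) : continuous (fun t : I => clamp (a * ui_val t + b)).
Proof.
apply: continuous_comp2; last exact: clamp_continuous.
by apply: continuous_affine; exact: ui_val_continuous.
Qed.

Lemma concat_continuousl (x y z : X) (q : {path I from y to z}) :
  continuous (fun p : {path I from x to y} => concat p q).
Proof.
apply: (path_map_continuous (@ui_le 2^-1) (@clamp_affine 2 0)) => [p t|p p' t].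
  by move=> /= t2; rewrite /mk_path /concat_fun t2 addr0.
by move=> /= /negP/negbTE t2; rewrite /mk_path /concat_fun t2.
Qed.

Lemma concat_continuousr (x y z : X) (p : {path I from x to y}) :
  continuous (fun q : {path I from y to z} => concat p q).
Proof.
apply: (path_map_continuous (@ui_ge 2^-1) (@clamp_affine 2 (-1)))
    => [q t|q q' t] /=; rewrite /mk_path /concat_fun.
  (* The closed half includes the midpoint, where [concat] follows [p]; there [p one] and [q zero]
     are both [y]. *)
  case: ltgtP => // <- _; rewrite mulfV ?pnatr_eq0 // subrr.
  by rewrite clamp_ge1 // clamp_le0 // path_one path_zero.
by move=> /negP; rewrite -ltNge => /ltW ->.
Qed.

Lemma reverse_continuous (x y : X) :
  continuous (fun p : {path I from x to y} => reverse p).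
Proof.
apply: (path_map_continuous closedT (@clamp_affine (-1) 1)) => [p t _|p q t []].
  by rewrite /= /mk_path /reverse_fun mulN1r addrC.
exact: Logic.I.
Qed.

End loop_operations.

Section fundamental_group_topology.
Variables (R : realType) (X : topologicalType).
Local Notation I := (unit_interval R).
Local Open Scope group_scope.

Lemma pi1_openE (x : X) (U : set (pi1 R x)) :
  open U = open (@homotopy_class R X x @^-1` U).
Proof. by []. Qed.

Lemma pi1_inv_continuous (x : X) : continuous (fun g : pi1 R x => g^-1).
Proof.
apply/continuousP => U oU; rewrite pi1_openE.
have -> : @homotopy_class R X x @^-1` ((fun g => g^-1) @^-1` U) =
    (fun p : loop_space R x => reverse p) @^-1` (@homotopy_class R X x @^-1` U).
  by apply/seteqP; split=> a /=; rewrite -pi1_invE.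
by move/continuousP: (@reverse_continuous R X x x); apply.
Qed.

(** Right translation is covered by concatenation with a fixed representative of [h], and continuity
    out of a quotient is tested on the loop space. *)
Lemma pi1_mul_continuousl (x : X) (h : pi1 R x) :
  continuous (fun g : pi1 R x => g * h).
Proof.
elim/pi1_ind: h => b; apply/continuousP => U oU; rewrite pi1_openE.
have -> : @homotopy_class R X x @^-1` ((fun g => g * homotopy_class b) @^-1` U)
    = (fun p : loop_space R x => concat p b) @^-1` (@homotopy_class R X x @^-1` U).
  by apply/seteqP; split=> a /=; rewrite -pi1_mulE.
by move/continuousP: (@concat_continuousl R X x x x b); apply.
Qed.

Definition pi1_indiscernible (x : X) : set (pi1 R x) :=
  [set g | forall U, open_nbhs (1 : pi1 R x) U -> U g].

Lemma pi1_indiscernible_group_closed (x : X) :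
  group_closed (mem (@pi1_indiscernible x)).
Proof.
split=> [|g h]; rewrite !inE; first by move=> U [].
move=> gN hN U [oU U1].
(* This translate contains 1 exactly when [h^-1] lies in [U], which is [hN] applied to the inverse
   image of [U] under inversion. *)
apply: (gN [set k | U (k * h^-1)]); split.
  by move/continuousP: (@pi1_mul_continuousl x h^-1); apply.
rewrite /= mul1g; apply: (hN [set k | U k^-1]); split; last by rewrite /= invg1.
by move/continuousP: (@pi1_inv_continuous x); apply.
Qed.

Lemma small_loop_open (y : X) (b : loop_space R y) (W : set (loop_space R y)) :
  small_loop b -> open W -> W (constant_loop R y) ->
  exists2 c, homotopic b c & W c.
Proof.
move=> sb oW We; have [V [oV Vy VW]] := nbhs_cst_path oW We.
by have [c bc cV] := sb V oV Vy; exists c => //; exact: VW.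
Qed.

Lemma sg_generator_indiscernible (x : X) :
  sg_generator R x `<=` @pi1_indiscernible x.
Proof.
(* The small loop is a representative [b'] of the class of [b], not [b] itself, so conjugation must
   respect homotopy. *)
move=> _ [y [a [b [[b' sb' bb'] ->]]]] U [oU U1].
pose conj (c : loop_space R y) : loop_space R x :=
  concat (concat a c) (reverse a).
have conj_homotopic c d : homotopic c d ->
    homotopy_class (conj c) = homotopy_class (conj d).
  move=> cd; apply/homotopy_classP.
  apply: homotopic_concat; last exact: homotopic_refl.
  by apply: homotopic_concat => //; exact: homotopic_refl.
have oW : open ((@homotopy_class R X x \o conj) @^-1` U).
  have cconj : continuous conj.
    apply: (@continuous_comp2 _ _ _ (fun c => concat a c)
      (fun p => concat p (reverse a))).
      exact: concat_continuousr.
    exact: concat_continuousl.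
  by move/continuousP: cconj => /(_ _ oU).
have We : U (homotopy_class (conj (constant_loop R y))).
  suff -> : homotopy_class (conj (constant_loop R y)) = 1 by [].
  apply/homotopy_classP; apply: homotopic_trans (concatpV a).
  by apply: homotopic_concat; [exact: concatp1|exact: homotopic_refl].
have [c b'c Uc] := small_loop_open sb' oW We.
rewrite -/(conj b) (conj_homotopic b c) //.
by apply: homotopic_trans b'c; apply/homotopy_classP.
Qed.

Lemma pi1_sg_indiscernible (x : X) : pi1_sg R x `<=` @pi1_indiscernible x.
Proof.
apply: smallest_sub; first exact: pi1_indiscernible_group_closed.
exact: sg_generator_indiscernible.
Qed.

(** Every subgroup in the intersection defining [pi1_sg] is stable under inverses. *)
Lemma pi1_sgV (x : X) (g : pi1 R x) : pi1_sg R x g -> pi1_sg R x g^-1.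
Proof.
move=> gS H [Hgrp HS].
have gH : g \in mem H by rewrite inE; exact: gS.
by have := group_closedV Hgrp gH; rewrite inE.
Qed.

End fundamental_group_topology.

Theorem theorem2p2 (R : realType) (X : topologicalType) (x : X) :
  (forall U : set (pi1 R x), open_nbhs (1%g : pi1 R x) U ->
     pi1_sg R x `<=` U) /\
  pi1_sg R x `<=` closure [set (1%g : pi1 R x)].
Proof.
have sgU U : open_nbhs (1%g : pi1 R x) U -> pi1_sg R x `<=` U.
  by move=> U1 g /pi1_sg_indiscernible; apply.
split=> // g gS B; rewrite nbhsE => -[U [oU Ug] UB].
exists 1%g; split=> //; apply: UB; rewrite -(mulVg g).
(* This translate of [U] is a neighborhood of 1 because [g] lies in [U]. *)
apply: (sgU [set k | U (k * g)%g]); last exact: pi1_sgV.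
split; last by rewrite /= mul1g.
by move/continuousP: (@pi1_mul_continuousl R X x g); apply.
Qed.
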